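(* Let $V$ be a finite dimensional representation over $\mathbb{F}_q$ of a finite group $G$. Assume there are an involution $\iota\colon G\to G$, $g\mapsto g^\iota$, and a non-degenerate symmetric bilinear form $b\colon V\times V\to\mathbb{F}_q$ such that $b(gx,g^\iota y)=b(x,y)$ for all $g\in G$ and $x,y\in V$. Let $\mathcal{O}_1,\dots,\mathcal{O}_r$ be all the distinct $G$-orbits in $V$, with indicator functions $e_1,\dots,e_r$. Then for any subspace $W$ of $V$, $$\sum_{1\le i\le r}\frac{|\mathcal{O}_i\cap W|}{|\mathcal{O}_i|}\cdot\widehat{e_i}=\frac{|W|}{|V|}\sum_{1\le i\le r}\frac{|\mathcal{O}_i\cap W^\perp|}{|\mathcal{O}_i|}\cdot e_i.$$
   Context: An involution of $G$ here means a group automorphism of order $1$ or $2$. $p=\mathrm{char}(\mathbb{F}_q)$. $W^\perp=\{y\in V: b(x,y)=0 \text{ for all } x\in W\}$. For $\phi\colon V\to\mathbb{C}$, the Fourier transform (with respect to $b$) is $$\widehat\phi(y)=|V|^{-1}\sum_{x\in V}\phi(x)\exp\left(2\pi\sqrt{-1}\cdot\frac{\mathrm{Tr}_{\mathbb{F}_q/\mathbb{F}_p}(b(x,y))}{p}\right),\qquad y\in V.$$ *)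

(* Defs.v *)
From HB Require Import structures.
From mathcomp Require Import all_boot all_order all_algebra.
From mathcomp Require Import all_fingroup all_solvable all_field.
From mathcomp Require Import sesquilinear.
From mathcomp Require Import reals sequences exp trigo.
From mathcomp Require Import complex.

Set Implicit Arguments.
Unset Strict Implicit.
Unset Printing Implicit Defensive.

Import GRing.Theory.
Local Open Scope ring_scope.
Local Open Scope complex_scope.

(* Left linear action of a finite group on a vector space; note that the
   composition (f \o g)%VF applies g first. *)
Definition is_representation (G : finGroupType) (F : fieldType)
    (V : vectType F) (rho : G -> 'End(V)) : Prop :=
  rho 1%g = \1%VF /\ forall g h : G, rho (g * h)%g = (rho g \o rho h)%VF.

Section Orbits.
Variables (G : finGroupType) (F : finFieldType) (V : vectType F).

Definition repr_orbit (rho : G -> 'End(V)) (x : finvect_type V) :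
    {set finvect_type V} :=
  [set (rho g x : finvect_type V) | g : G].

Definition repr_orbits (rho : G -> 'End(V)) : {set {set finvect_type V}} :=
  [set repr_orbit rho x | x : finvect_type V].

Definition vspace_set (W : {vspace V}) : {set finvect_type V} :=
  [set x : finvect_type V | (x : V) \in W].

End Orbits.

Section Trace.
Variables (F : finFieldType) (p : nat) (charFp : p \in [pchar F]).
Local Notation L := (pPrimeCharType charFp).

(* galTrace is valued in L itself; its value lies in the image of 'F_p, see
   field_traceE, and field_trace is that value read in 'F_p. *)
Definition field_trace (a : F) : 'F_p :=
  odflt 0 [pick c : 'F_p | c%:A == galTrace 1 {:L} (a : L)].

Lemma field_traceE (a : F) :
  (field_trace a)%:A = galTrace 1 {:L} (a : L) :> L.
Proof.
rewrite /field_trace; case: pickP => [c /eqP //|no_c].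
have : galTrace 1 {:L} (a : L) \in 1%VS.
  by apply: mem_galTrace; [exact: finField_galois (sub1v _) | exact: memvf].
by case/vlineP=> c def_c; have /eqP[] := no_c c.
Qed.

End Trace.

Section Fourier.
Variable R : realType.

Definition cexp (z : R[i]) : R[i] :=
  (expR (Re z))%:C * (cos (Im z) +i* sin (Im z)).

Variables (F : finFieldType) (p : nat) (charFp : p \in [pchar F]).
Variable V : vectType F.

Definition fourier (b : V -> V -> F) (phi : {ffun finvect_type V -> R[i]}) :
    {ffun finvect_type V -> R[i]} :=
  [ffun y : finvect_type V =>
    #|finvect_type V|%:R^-1 * \sum_(x : finvect_type V)
      phi x * cexp (2%:R * pi%:C * (0 +i* 1) *
                    (field_trace charFp (b x y) : nat)%:R / p%:R)].

Definition indicator (A : {set finvect_type V}) :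
    {ffun finvect_type V -> R[i]} :=
  [ffun x => (x \in A)%:R].

End Fourier.

(* Main.v *)
Require Import Defs.
From mathcomp Require Import all_boot all_order all_algebra.
From mathcomp Require Import all_fingroup all_solvable all_field.
From mathcomp Require Import sesquilinear reals complex.
From mathcomp Require Import exp trigo ring.

(** Write [psi] for the additive character of the field F used by the Fourier
    transform, that is, the trace followed by k |-> exp (2 pi i k / p); it is
    [trace_char] below.

    The coefficients [|O i :&: A| / |O i|] are those that turn a sum over
    orbits into an average over the group: since x |-> rho g x runs evenly over
    the orbit of x, for every set [A] and function [f],
      [\sum_i |O i :&: A| / |O i| * \sum_(z in O i) f z
       = |G|^-1 * \sum_(x in A) \sum_g f (rho g x)]
    ([sum_orbit_average]). Both sides of the theorem, evaluated at [y], have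
    this shape: on the left [A] is W and [f x = psi (b x y)], on the right [A]
    is the orthogonal of W and [f] is the indicator function of y.

    On the left, invariance of the form moves g to the other argument,
    [b (rho g w) y = b w (rho (iota g)^-1 y)], and summing over w in W gives
    |W| if [rho (iota g)^-1 y] is orthogonal to W, and 0 otherwise: this is
    the orthogonality relation for characters of the finite group W
    ([sum_trace_char]). As [iota] is a bijection of G, [iota g] can be replaced
    by g in the sum over the group. On the right, the only x with
    [rho g x = y] is [rho g^-1 y], so that one again counts the g for which
    this vector is orthogonal to W.

    The orthogonality relation needs [psi] to be a non-trivial morphism, which
    holds because exp (2 pi i / p) is a primitive p-th root of unity
    ([unit_root_prim]) and because the trace is additive and not identically 0
    ([field_traceD], [field_trace_neq0]). *)

Set Implicit Arguments.
Unset Strict Implicit.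
Unset Printing Implicit Defensive.

Import Order.TTheory GRing.Theory Num.Theory.
Local Open Scope ring_scope.
Local Open Scope complex_scope.

(** * The root of unity exp (2 pi i / p) *)

Section RootOfUnity.
Variable R : realType.

Definition unit_root (p : nat) : R[i] :=
  cos (pi *+ 2 / p%:R) +i* sin (pi *+ 2 / p%:R).

Lemma de_moivre (x : R) n :
  (cos x +i* sin x) ^+ n = cos (x *+ n) +i* sin (x *+ n).
Proof.
elim: n => [|n IHn]; first by rewrite expr0 mulr0n cos0 sin0.
rewrite exprS IHn mulrS cosD sinD; apply/eqP; rewrite eq_complex /=.
by rewrite eqxx addrC eqxx.
Qed.

(** Rewrites the exponential in the definition of [fourier] as a power, after
    which only the order of the root matters. *)
Lemma cexp_unit_root p k :
  cexp (2%:R * pi%:C * (0 +i* 1) * k%:R / p%:R) = unit_root p ^+ k.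
Proof.
have -> : 2%:R * pi%:C * (0 +i* 1) * k%:R / p%:R
    = 0 +i* (pi *+ 2 / p%:R *+ k) :> R[i].
  have -> : pi *+ 2 / p%:R *+ k = 2%:R * pi * (k%:R / p%:R) :> R.
    by rewrite mulr_natl mulrA mulr_natr -mulrnAl.
  have natC n : n%:R = n%:R%:C :> R[i] by rewrite rmorph_nat.
  rewrite -[LHS]mulrA (natC k) (natC p) (natC 2%N) -fmorphV -!rmorphM /=.
  by rewrite -mulrA [X in _ * X]mulrC mulrA -rmorphM; simpc.
by rewrite /cexp de_moivre /= expR0 mul1r.
Qed.

(** Let x = pi (i + 1) / p. If 0 < i + 1 < p then 0 < x < pi, hence sin x is
    nonzero and cos (2 x) = 1 - 2 sin x ^ 2 differs from 1. *)
Lemma unit_root_prim p : (0 < p)%N -> p.-primitive_root (unit_root p).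
Proof.
move=> p_gt0; have p_neq0 : p%:R != 0 :> R by rewrite pnatr_eq0 -lt0n.
apply/andP; split=> //; apply/forallP=> i; rewrite unity_rootE de_moivre.
have ip : (i.+1 <= p)%N by [].
rewrite eqn_leq ip /=; apply/eqP; case: (ltnP i.+1 p) => [lt_ip|le_pi].
  apply/negP=> /eqP[cos1 _].
  pose x : R := pi / p%:R *+ i.+1.
  have x_in : 0 < x < pi.
    rewrite /x -mulr_natr -mulrA !pmulr_rgt0 ?pi_gt0 ?invr_gt0 ?ltr0n //=.
    rewrite gtr_pMr ?pi_gt0 // mulrC ltr_pdivrMr ?ltr0n // mul1r.
    by rewrite ltr_nat.
  have xE : pi *+ 2 / p%:R *+ i.+1 = x *+ 2 by rewrite /x mulrnAl mulrnAC.
  move: cos1; rewrite xE cos_mulr2n cos2sin2 => /eqP.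
  rewrite subr_eq -mulr2n eqrMn2r //= subr_eq addrC -subr_eq subrr eq_sym.
  by rewrite sqrf_eq0 gt_eqF // sin_gt0_pi.
have -> : i.+1 = p by apply/eqP; rewrite eqn_leq ip.
have -> : pi *+ 2 / p%:R *+ p = pi *+ 2 :> R by rewrite -mulr_natr divfK.
by rewrite cos2pi sin2pi eqxx.
Qed.

End RootOfUnity.

(** * The additive character given by the trace *)

Section TraceCharacter.
Variables (F : finFieldType) (p : nat) (charFp : p \in [pchar F]).
Local Notation L := (pPrimeCharType charFp).

Lemma field_traceD : {morph field_trace charFp : a b / a + b}.
Proof.
move=> a b; apply: (fmorph_inj (in_alg L)).
by rewrite rmorphD /= !field_traceE raddfD.
Qed.

(** The trace is a sum of distinct field automorphisms, and these are linearly
    independent. *)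
Lemma field_trace_neq0 : exists a, field_trace charFp a != 0.
Proof.
have [a _] := @gal_independent_contra _ _ {:L} [in 'Gal({:L} / 1)%g]
  (fun=> 1) _ (group1 _) (oner_neq0 _).
rewrite (eq_bigr (fun x : gal_of {:L} => x a)) => [tr_a|x _]; last exact: mul1r.
exists a; apply: contraNneq tr_a => tr0.
by have := field_traceE charFp a; rewrite tr0 scale0r => /esym/eqP.
Qed.

End TraceCharacter.

Lemma symmetric_formC (K : fieldType) (V : vectType K) (b : {symmetric V})
    (x y : V) : b x y = b y x.
Proof. by rewrite hermC /= expr0 mul1r. Qed.

Section TraceCharacterValue.
Variables (R : realType) (F : finFieldType) (p : nat).
Variable charFp : p \in [pchar F].

Definition trace_char (a : F) : R[i] :=
  unit_root R p ^+ (field_trace charFp a : nat).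

Let p_prime : prime p := pcharf_prime charFp.

Lemma trace_charD a b : trace_char (a + b) = trace_char a * trace_char b.
Proof.
rewrite /trace_char field_traceD -exprD /=.
rewrite -[RHS](prim_expr_mod (unit_root_prim R (prime_gt0 p_prime))).
by rewrite /= [X in (_ %% X)%N]Fp_cast.
Qed.

Lemma trace_char0 : trace_char 0 = 1.
Proof.
suff tr0 : field_trace charFp 0 = 0 by rewrite /trace_char tr0 expr0.
by apply: (addrI (field_trace charFp 0)); rewrite -field_traceD !addr0.
Qed.

Lemma trace_char_neq1 : exists a, trace_char a != 1.
Proof.
have [a tr_a] := field_trace_neq0 charFp; exists a.
rewrite -(prim_order_dvd (unit_root_prim R (prime_gt0 p_prime))).
have tr_gt0 : (0 < field_trace charFp a)%N by rewrite lt0n.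
rewrite gtnNdvd //; have := ltn_ord (field_trace charFp a).
by rewrite [X in (_ < X)%N -> _]Fp_cast.
Qed.

(** If some w in W is not orthogonal to y, then a multiple u of w
    has [b u y = a] with [trace_char a != 1]; translating the summation variable
    by u multiplies the sum by [trace_char a], so that the sum is 0. *)
Lemma sum_trace_char (V : vectType F) (b : {symmetric V}) (W : {vspace V})
    (y : V) :
  \sum_(x in vspace_set W) trace_char (b x y) =
  #|vspace_set W|%:R * (y \in orthov b W)%:R.
Proof.
have [/mem_orthovP yW|/mem_orthovPn[w wW byw]] := boolP (y \in orthov b W).
  rewrite mulr1 -sumr_const; apply: eq_bigr => x; rewrite inE => xW.
  by rewrite symmetric_formC yW // trace_char0.
rewrite mulr0; have [a chi_a] := trace_char_neq1.
pose u : finvect_type V := (a / b w y) *: w.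
have buy : b u y = a.
  by rewrite linearZl_LR /= divfK // symmetric_formC.
apply/eqP; rewrite -(inj_eq (mulfI (_ : 1 - trace_char a != 0))); last first.
  by rewrite subr_eq0 eq_sym.
rewrite mulr0 mulrBl mul1r subr_eq0 mulr_sumr; apply/eqP.
rewrite (reindex_inj (addrI u)) /=; apply: eq_big => x.
  by rewrite !inE rpredDl // rpredZ.
by rewrite linearDl /= trace_charD buy.
Qed.

End TraceCharacterValue.

(** * Averages over orbits *)

Section OrbitAverage.
Variables (C : numFieldType) (G : finGroupType) (F : finFieldType).
Variables (V : vectType F) (rho : G -> 'End(V)).
Hypothesis rhoP : is_representation rho.

Lemma reprM g h x : rho (g * h)%g x = rho g (rho h x).
Proof. by rewrite rhoP.2 lfunE. Qed.

Lemma reprK g : cancel (rho g) (rho g^-1%g).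
Proof. by move=> x; rewrite -reprM mulVg rhoP.1 lfunE. Qed.

Lemma reprVK g : cancel (rho g^-1%g) (rho g).
Proof. by move=> x; rewrite -reprM mulgV rhoP.1 lfunE. Qed.

Lemma repr_orbit_refl x : x \in repr_orbit rho x.
Proof. by apply/imsetP; exists 1%g; rewrite // rhoP.1 lfunE. Qed.

Lemma mem_repr_orbit g x y :
  (rho g y \in repr_orbit rho x) = (y \in repr_orbit rho x).
Proof.
apply/imsetP/imsetP=> -[h _]; last by move->; exists (g * h)%g; rewrite ?reprM.
by move/(canRL (reprK g))->; exists (g^-1 * h)%g; rewrite ?reprM.
Qed.

Lemma repr_orbit_eq x y :
  x \in repr_orbit rho y -> repr_orbit rho x = repr_orbit rho y.
Proof.
move=> /imsetP[h _ ->]; apply/setP=> z; apply/imsetP/imsetP=> -[g _ ->].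
  by exists (g * h)%g; rewrite ?reprM.
by exists (g * h^-1)%g; rewrite ?reprM ?reprK.
Qed.

(** Double counting of the sum of [f (rho g z)] over g in G and z in the orbit:
    the inner sum over g is the same for all z, since translating g moves z
    within the orbit; the inner sum over z is the same for all g, since [rho g]
    permutes the orbit. This takes the place of a count of stabilisers. *)
Lemma sum_repr_orbit (f : finvect_type V -> C) x :
  #|repr_orbit rho x|%:R * \sum_g f (rho g x) =
  #|G|%:R * \sum_(z in repr_orbit rho x) f z.
Proof.
transitivity (\sum_(z in repr_orbit rho x) \sum_g f (rho g z)).
  rewrite mulr_natl -sumr_const; apply: eq_bigr => z /imsetP[h _ ->].
  rewrite (reindex_inj (mulIg h)); apply: eq_bigr => g _.
  by rewrite reprM.
rewrite exchange_big mulr_natl -sumr_const; apply: eq_bigr => g _.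
have rho_inj : @injective (finvect_type V) (finvect_type V) (rho g).
  exact: can_inj (reprK g).
rewrite [RHS](reindex_inj rho_inj) /=; apply: eq_bigl => z.
by rewrite mem_repr_orbit.
Qed.

(** Group the sum over [A] according to the orbit [O i] of x: every such x
    contributes |G| times the mean of [f] on [O i], by [sum_repr_orbit]. *)
Lemma sum_orbit_average r (O : 'I_r -> {set finvect_type V}) :
    injective O -> [set O i | i : 'I_r] = repr_orbits rho ->
  forall (A : {set finvect_type V}) (f : finvect_type V -> C),
  #|G|%:R * \sum_i #|O i :&: A|%:R / #|O i|%:R * \sum_(z in O i) f z =
  \sum_(x in A) \sum_g f (rho g x).
Proof.
move=> O_inj O_orbits A f.
have memO i x : (x \in O i) = (O i == repr_orbit rho x).
  have /imsetP[y _ ->] : O i \in repr_orbits rho by rewrite -O_orbits imset_f.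
  apply/idP/eqP=> [/repr_orbit_eq->//|->]; exact: repr_orbit_refl.
transitivity (\sum_(x in A) \sum_(i | x \in O i) \sum_g f (rho g x)).
  rewrite mulr_sumr (exchange_big_dep xpredT) //=; apply: eq_bigr => i _.
  transitivity (\sum_(x in O i :&: A)
                  #|G|%:R / #|O i|%:R * \sum_(z in O i) f z).
    by rewrite sumr_const -mulr_natl; ring.
  apply: eq_big => [x|x /setIP[]]; first by rewrite inE andbC.
  rewrite memO => /eqP Ox _.
  have O_neq0 : #|O i|%:R != 0 :> C.
    rewrite pnatr_eq0 -lt0n; apply/card_gt0P; exists x.
    by rewrite Ox repr_orbit_refl.
  by apply: (mulfI O_neq0); rewrite Ox sum_repr_orbit -Ox; field.
apply: eq_bigr => x _.
have /imsetP[i _ Oi] : repr_orbit rho x \in [set O i | i : 'I_r].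
  by rewrite O_orbits imset_f.
rewrite (big_pred1 i) // => j; rewrite memO Oi; exact: inj_eq.
Qed.

End OrbitAverage.

(** * The theorem *)

Lemma sum_delta (S : pzSemiRingType) (T : finType) (A : {set T}) (y : T) :
  \sum_(x in A) (x == y)%:R = (y \in A)%:R :> S.
Proof.
case: (boolP (y \in A)) => [yA|yNA].
  by rewrite (bigD1 y yA) /= eqxx big1 ?addr0 // => x /andP[_ /negPf->].
by rewrite big1 // => x xA; case: eqP => // xy; rewrite -xy xA in yNA.
Qed.

Theorem proposition6 (R : realType) (F : finFieldType) (p : nat)
    (charFp : p \in [pchar F]) (G : finGroupType) (V : vectType F)
    (rho : G -> 'End(V)) (rho_repr : is_representation rho)
    (iota : {perm G}) (iota_aut : iota \in Aut [set: G])
    (iota_order : (#[iota]%g = 1 \/ #[iota]%g = 2)%N)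
    (b : {symmetric V}) (b_nondeg : nondegenerate b)
    (b_inv : forall (g : G) (x y : V), b (rho g x) (rho (iota g) y) = b x y)
    (r : nat) (O : 'I_r -> {set finvect_type V}) (O_inj : injective O)
    (O_orbits : [set O i | i : 'I_r] = repr_orbits rho)
    (W : {vspace V}) :
  \sum_(i < r) ((#|O i :&: vspace_set W|%:R / #|O i|%:R : R[i]) *:
                fourier charFp b (indicator R (O i))) =
  (#|vspace_set W|%:R / #|finvect_type V|%:R : R[i]) *:
    \sum_(i < r) ((#|O i :&: vspace_set (orthov b W)|%:R / #|O i|%:R : R[i]) *:
                  indicator R (O i)).
Proof.
(* Clearing the factor |G|, which is nonzero in R[i], makes both sides
   instances of the orbit average. *)
apply/ffunP=> y.
have G_neq0 : #|G|%:R != 0 :> R[i].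
  by rewrite pnatr_eq0 -lt0n; apply/card_gt0P; exists 1%g.
have avg := sum_orbit_average (C := R[i]) rho_repr O_inj O_orbits.
apply: (mulfI G_neq0).
transitivity (#|finvect_type V|%:R^-1 *
  \sum_(w in vspace_set W) \sum_g trace_char R charFp (b (rho g w) y)).
  rewrite -(avg _ (fun x => trace_char R charFp (b x y))) mulrCA sum_ffunE.
  congr (_ * _); rewrite mulr_sumr; apply: eq_bigr => i _.
  rewrite !ffunE mulrCA; congr (_ * (_ * _)).
  rewrite [RHS]big_mkcond; apply: eq_bigr => x _.
  by rewrite ffunE cexp_unit_root; case: ifP; rewrite (mul1r, mul0r).
transitivity (#|vspace_set W|%:R / #|finvect_type V|%:R *
    \sum_(u in vspace_set (orthov b W)) \sum_g (rho g u == y)%:R : R[i]);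
    last first.
  rewrite -(avg _ (fun u => (u == y)%:R)) ffunE mulrCA sum_ffunE.
  congr (_ * (_ * _)); apply: eq_bigr => i _.
  by rewrite !ffunE sum_delta.
rewrite mulrAC -[RHS]mulrC; congr (_ * _).
rewrite exchange_big /= [in RHS]exchange_big mulr_sumr /=.
(* Write y as [rho (iota g) (rho (iota g)^-1 y)] and use invariance. *)
transitivity (\sum_g \sum_(w in vspace_set W)
   trace_char R charFp (b w (rho (iota g)^-1%g y))).
  apply: eq_bigr => g _; apply: eq_bigr => w _.
  by rewrite -[in LHS](reprVK rho_repr (iota g) y) b_inv.
rewrite (reindex_inj (perm_inj (s := iota^-1%g))) /=; apply: eq_bigr => g _.
rewrite permKV sum_trace_char; congr (_ * _).
transitivity (\sum_(u in vspace_set (orthov b W))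
    (u == (rho g^-1%g y : finvect_type V))%:R : R[i]).
  by rewrite sum_delta inE.
apply: eq_bigr => u _; congr (nat_of_bool _)%:R.
by rewrite -(can2_eq (reprK rho_repr g) (reprVK rho_repr g)).
Qed.
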